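(* Let $n\ge 1$ and $d\ge 1$ be integers and let $y\in\mathbb{R}^n$. The function $f_\infty:\mathbb{R}^n\to\mathbb{R}$ defined by $$f_\infty(x) := \max_{1\le i_1,\dots,i_d\le n} \left|x_{i_1}\cdots x_{i_d} - y_{i_1}\cdots y_{i_d}\right|$$ is a weakly global function; in particular, it has no spurious strict local minima, i.e. every point $x\in\mathbb{R}^n$ that is a strict local minimum of $f_\infty$ is a global minimum of $f_\infty$.
   Context: Let $S\subset\mathbb{R}^n$ and $f:S\to\mathbb{R}$, and let $\|\cdot\|_2$ be the Euclidean norm. Points: $x\in S$ is a global minimum of $f$ if $f(x)\le f(y)$ for all $y\in S\setminus\{x\}$. It is a strict local minimum of $f$ if there exists $\epsilon>0$ such that $f(x)<f(y)$ for all $y\in S\setminus\{x\}$ with $\|x-y\|_2\le\epsilon$. Sets: a subset $X\subset S$ is a global minimum of $f$ if $\inf_X f\le \inf_{S\setminus X} f$ (infima in the extended reals, $\inf\emptyset=+\infty$). A nonempty compact subset $X\subset S$ is a strict local minimum of $f$ if there exists $\epsilon>0$ such that for all $x\in X$ and all $y\in S\setminus X$ with $\|x-y\|_2\le\epsilon$, one has $f(x)<f(y)$. Weakly global function: $f:S\to\mathbb{R}$ is weakly global if it is continuous and every (nonempty compact) set that is a strict local minimum of $f$ is a global minimum of $f$ in the sense of sets. *)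

(* Defs.v *)
From mathcomp Require Import all_boot all_order all_algebra.
From mathcomp Require Import all_classical all_reals all_analysis.

Set Implicit Arguments.
Unset Strict Implicit.
Unset Printing Implicit Defensive.

Import Order.TTheory GRing.Theory Num.Theory.
Import numFieldNormedType.Exports.

Local Open Scope classical_set_scope.
Local Open Scope ring_scope.

(* The library norm on row vectors is the sup norm, hence this definition;
   both norms induce the same topology, so the library's notions of continuity
   and compactness on 'rV[R]_n are the usual ones. *)
Definition euclidean_norm (R : realType) (n : nat) (x : 'rV[R]_n) : R :=
  Num.sqrt (\sum_(i < n) x 0 i ^+ 2).

(* A function S -> R is represented by a total function on 'rV[R]_n whose values
   outside of S are never looked at. *)

Definition global_min_point (R : realType) (n : nat) (S : set 'rV[R]_n)
    (f : 'rV[R]_n -> R) (x : 'rV[R]_n) : Prop :=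
  S x /\ forall y, (S `\ x) y -> f x <= f y.

Definition strict_local_min_point (R : realType) (n : nat) (S : set 'rV[R]_n)
    (f : 'rV[R]_n -> R) (x : 'rV[R]_n) : Prop :=
  S x /\ exists2 eps : R, 0 < eps &
    forall y, (S `\ x) y -> euclidean_norm (x - y) <= eps -> f x < f y.

Definition global_min_set (R : realType) (n : nat) (S : set 'rV[R]_n)
    (f : 'rV[R]_n -> R) (X : set 'rV[R]_n) : Prop :=
  X `<=` S /\
  (ereal_inf [set (f x)%:E | x in X] <=
   ereal_inf [set (f x)%:E | x in S `\` X])%E.

Definition strict_local_min_set (R : realType) (n : nat) (S : set 'rV[R]_n)
    (f : 'rV[R]_n -> R) (X : set 'rV[R]_n) : Prop :=
  [/\ X `<=` S, X !=set0, compact X &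
      exists2 eps : R, 0 < eps &
        forall x y, X x -> (S `\` X) y ->
          euclidean_norm (x - y) <= eps -> f x < f y].

Definition weakly_global (R : realType) (n : nat) (S : set 'rV[R]_n)
    (f : 'rV[R]_n -> R) : Prop :=
  {within S, continuous f} /\
  forall X : set 'rV[R]_n, strict_local_min_set S f X -> global_min_set S f X.

(* The multi-index (i_1, ..., i_d) is a function i : 'I_d -> 'I_n. The default
   value 0 of the iterated maximum is harmless: all the terms are nonnegative,
   and there is at least one of them when 0 < n. *)
Definition f_infty (R : realType) (n d : nat) (y x : 'rV[R]_n) : R :=
  \big[Num.max/0]_(i : {ffun 'I_d -> 'I_n})
     `| \prod_(k < d) x 0 (i k) - \prod_(k < d) y 0 (i k) |.

(* Main.v *)
Require Import Defs.
From mathcomp Require Import all_boot all_order all_algebra.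
From mathcomp Require Import all_classical all_reals all_analysis.
From mathcomp Require Import lra ring.

Set Implicit Arguments.
Unset Strict Implicit.
Unset Printing Implicit Defensive.

Import Order.TTheory GRing.Theory Num.Theory.
Import numFieldNormedType.Exports.

Local Open Scope classical_set_scope.
Local Open Scope ring_scope.

(** The argument shows more than asked: every nonempty compact strict local
minimum [X] contains a point where [f_infty d y] vanishes, hence a global
minimum since the function is nonnegative.

Let [c] be the minimum of [f = f_infty d y] over [X], reached at [x]. A
continuous path that starts in [X] and stays in the sublevel set [f <= c] cannot
leave [X]: it sits at level exactly [c] as long as it is in [X], while the points
just outside of [X] are at a level greater than [c]
([sublevel_path_trapped]). So, when [c > 0], it suffices to join [x] to a zero of
[f] inside [f <= c] ([reach_zero]).

Write [y_I] for the product of the [y_i] over the multi-index [I], and let [j]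
maximize [|y_j|]. Call a coordinate [i] small if [|y_i| |y_j|^(d-1) <= c]: this
says that [|y_I| <= c] for every [I] that meets [i]. The path has three pieces.

- Scaling the small coordinates of [x] down to 0 moves each product they occur
  in from [x_I] to 0, and both ends are within [c] of [y_I] ([collapse_path]).
- If [i] is not small, the multi-index [(i, j, ..., j)] has [|y_I| > c], so
  [x_I] and [y_I] have the same sign. Comparing these signs gives [s = 1] or
  [s = -1] with [s^d = 1] such that [x_i] has the sign of [s y_i] for every [i]
  that is not small ([aligned_sign]). As [s^d = 1], the point [z = s y] is a zero
  of [f], and [f_infty d z = f]. Now the small coordinates may be raised from 0
  to a small positive multiple of those of [z], after which each coordinate has
  the same sign as that of [z], zero included ([lift_path]).
- Coordinatewise geometric interpolation to [z] interpolates the products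
  geometrically as well, so all of them approach those of [z] monotonically
  ([geometric_path]). *)

(** * Continuity *)

Lemma continuous_prod (R : realType) (T : topologicalType) (I : Type)
    (r : seq I) (F : I -> T -> R) :
  (forall i, continuous (F i)) -> continuous (fun t => \prod_(i <- r) F i t).
Proof.
move=> cF; apply: continuous_big => [|//].
by move=> x; apply: continuousM; [exact: cvg_fst|exact: cvg_snd].
Qed.

Lemma continuous_row (R : realType) (T : topologicalType) (n : nat)
    (g : T -> 'rV[R]_n) :
  (forall j, continuous (fun t => g t 0 j)) -> continuous g.
Proof.
move=> cg t A [P nbhsP subA]; rewrite /= /nbhs /=.
have nearP : \forall s \near t, forall j, P 0 j (g s 0 j).
  apply: filter_forall => j; exact: (cg j t).
apply: filterS nearP => s Ps; apply: subA => i j.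
by rewrite (ord1 i).
Qed.

Lemma continuous_euclidean_norm (R : realType) (n : nat) :
  continuous (@euclidean_norm R n).
Proof.
move=> x; apply: (@continuous_comp _ _ _ _ (@Num.sqrt R)); last exact: sqrt_continuous.
apply: continuous_big x => [x|i _ x]; first exact: add_continuous.
rewrite (_ : (fun v : 'rV[R]_n => _) = fun v => v 0 i * v 0 i) ?funeqE //.
apply: continuousM; exact: coord_continuous.
Qed.

Lemma continuous_f_infty (R : realType) (n d : nat) (y : 'rV[R]_n) :
  continuous (f_infty d y).
Proof.
apply: continuous_big => [x|i _ x]; first exact: max_continuous.
apply: (@continuous_comp _ _ _
  (fun v : 'rV[R]_n => \prod_(k < d) v 0 (i k) - \prod_(k < d) y 0 (i k))
  (fun r : R => `|r|)); last exact: norm_continuous.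
apply: continuousB; last exact: cst_continuous.
apply: continuous_prod x => k x; exact: coord_continuous.
Qed.

(** * Paths in a sublevel set *)

Definition sublevel_path (R : realType) (n : nat) (f : 'rV[R]_n -> R) (c : R)
    (x x' : 'rV[R]_n) :=
  exists g : R -> 'rV[R]_n,
    [/\ continuous g, g 0 = x, g 1 = x' &
        forall t, 0 <= t <= 1 -> f (g t) <= c].

(** The times spent in [X] form a clopen subset of [[0, 1]]. Openness is where
strictness is used: at a time in [X] the level is at least [c], so a nearby point
out of [X] would be strictly above [c]. *)
Lemma sublevel_path_trapped (R : realType) (n : nat) (f : 'rV[R]_n -> R)
    (c : R) (X : set 'rV[R]_n) (x x' : 'rV[R]_n) :
  strict_local_min_set [set: 'rV[R]_n] f X ->
  (forall u, X u -> c <= f u) ->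
  sublevel_path f c x x' -> X x -> X x'.
Proof.
move=> [_ _ cptX [eps eps0 minX]] geX [g [cg <- <- gc]] Xx.
have clX : closed X := compact_closed (@norm_hausdorff _ _) cptX.
pose ball_at s := [set t | euclidean_norm (g s - g t) < eps].
pose inX := `[0, 1] `&` g @^-1` X.
have -> // : X (g 1) = inX 1.
  by apply/propext; split=> [?|[]//]; split => //=; rewrite in_itv/= ler01 lexx.
rewrite (_ : inX = `[0, 1]%classic); first by rewrite /= in_itv/= ler01 lexx.
apply: segment_connected.
- by exists 0; split => //=; rewrite in_itv/= ler01 lexx.
- exists (\bigcup_(s in inX) ball_at s).
    apply: bigcup_open => s _.
    apply: (@open_comp _ _ (fun t => euclidean_norm (g s - g t)) [set r | r < eps]).
      move=> t _; apply: continuous_comp; last exact: continuous_euclidean_norm.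
      apply: continuousB; [exact: cst_continuous|exact: cg].
    exact: open_lt.
  apply/seteqP; split=> t.
    move=> inXt; split; first by case: inXt.
    exists t => //=; rewrite /ball_at /= subrr /euclidean_norm big1 ?sqrtr0 // => i _.
    by rewrite mxE expr0n.
  move=> [t01 [s [s01 Xs] /= near_st]]; split=> //.
  apply: contrapT => nXt.
  have := minX _ _ Xs (conj I nXt) (ltW near_st).
  apply/negP; rewrite -leNgt; apply: le_trans (geX _ Xs); apply: gc.
  by move: t01; rewrite /= in_itv.
- exists (g @^-1` X); last by [].
  by apply: preimage_closed => // t _; exact: cg.
Qed.

(** * The three paths to a zero *)

(** The hypothesis [0 <= c] takes care of the default value of the iterated
maximum. *)
Lemma f_infty_leP (R : realType) (n d : nat) (y x : 'rV[R]_n) (c : R) :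
  0 <= c ->
  reflect (forall I : {ffun 'I_d -> 'I_n},
      `|\prod_(k < d) x 0 (I k) - \prod_(k < d) y 0 (I k)| <= c)
    (f_infty d y x <= c).
Proof.
move=> c0; apply: (iffP idP) => [/bigmax_leP[_ le_c] I|le_c]; first exact: le_c.
by apply/bigmax_leP; split.
Qed.

Lemma f_infty_ge0 (R : realType) (n d : nat) (y x : 'rV[R]_n) :
  0 <= f_infty d y x.
Proof. by apply: (big_ind (fun r : R => 0 <= r)) => // a b a0 b0; rewrite le_max a0. Qed.

Lemma f_infty_sign (R : realType) (n d : nat) (s : R) (y x : 'rV[R]_n) :
  s ^+ d = 1 -> f_infty d (s *: y) x = f_infty d y x.
Proof.
move=> sd1; apply: eq_bigr => I _; congr `|_ - _|.
under eq_bigr do rewrite mxE.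
by rewrite big_split /= prodr_const card_ord sd1 mul1r.
Qed.

Lemma normr_prod_le (R : realType) (d : nat) (a : 'I_d -> R) (B b : R)
    (k0 : 'I_d) :
  (forall k, `|a k| <= B) -> `|a k0| <= b ->
  `|\prod_(k < d) a k| <= b * B ^+ d.-1.
Proof.
move=> aB ab; rewrite normr_prod (bigD1 k0) //=.
apply: ler_pM => //; first by apply: prodr_ge0.
have -> : B ^+ d.-1 = \prod_(k < d | k != k0) B.
  by rewrite prodr_const cardC1 card_ord.
by apply: ler_prod => k _; rewrite normr_ge0 aB.
Qed.

(** Along this path each product is [tau * x_I] with [0 <= tau <= 1], hence by
convexity it is no further from [y_I] than the worse of [x_I] and 0; the
hypothesis on [A] says that 0 is within [c] of [y_I]. *)
Lemma collapse_path (R : realType) (n d : nat) (y x : 'rV[R]_n) (c : R)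
    (A : pred 'I_n) :
  0 <= c ->
  (forall (I : {ffun 'I_d -> 'I_n}) k, A (I k) ->
     `|\prod_(k < d) y 0 (I k)| <= c) ->
  f_infty d y x <= c ->
  sublevel_path (f_infty d y) c x (\row_i (if A i then 0 else x 0 i)).
Proof.
move=> c0 smallA /(f_infty_leP _ _ _ c0) fx.
exists (fun t => \row_i ((if A i then 1 - t else 1) * x 0 i)); split.
- apply: continuous_row => j t.
  rewrite (_ : (fun _ => _) = fun t => (if A j then 1 - t else 1) * x 0 j); last first.
    by apply/funext => u; rewrite mxE.
  apply: continuousM; last exact: cst_continuous.
  case: (A j); last exact: cst_continuous.
  by apply: continuousB => //; exact: cst_continuous.
- by apply/rowP => i; rewrite !mxE subr0 if_same mul1r.
- by apply/rowP => i; rewrite !mxE; case: (A i); rewrite ?subrr ?mul0r ?mul1r.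
move=> t /andP[t0 t1]; apply/f_infty_leP => // I.
under [X in `|X - _|]eq_bigr do rewrite mxE.
rewrite big_split /=; set tau := \prod_(k < d) _.
have [/existsP[k Ak]|/existsPn nA] := boolP [exists k, A (I k)]; last first.
  by rewrite /tau big1 ?mul1r // => k _; rewrite (negbTE (nA k)).
have tau0 : 0 <= tau.
  by apply: prodr_ge0 => j _; case: ifP => _ //; rewrite subr_ge0.
have tau1 : tau <= 1.
  apply: prodr_ile1 => j _; case: ifP => _; rewrite ?ler01 ?lexx //.
  by rewrite subr_ge0 t1 /= gerBl.
set p := \prod_(k < d) x 0 (I k); set q := \prod_(k < d) y 0 (I k).
rewrite (_ : tau * p - q = tau * (p - q) - (1 - tau) * q); last by ring.
have tau1' : 0 <= 1 - tau by rewrite subr_ge0.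
rewrite (le_trans (ler_normB _ _)) // !normrM (ger0_norm tau0) (ger0_norm tau1').
rewrite (_ : c = tau * c + (1 - tau) * c); last by ring.
by apply: lerD; apply: ler_wpM2l; rewrite ?fx ?(smallA I k).
Qed.

(** The products that meet [A] vanish at [x], so they remain smaller than [c] for
a small [delta]. They keep the sign of those of [z], which are also bounded by
[c], and two numbers of the same sign in [[-c, c]] are at distance at most
[c]. *)
Lemma lift_path (R : realType) (n d : nat) (z x : 'rV[R]_n) (c : R)
    (A : pred 'I_n) :
  0 < c ->
  (forall (I : {ffun 'I_d -> 'I_n}) k, A (I k) ->
     `|\prod_(k < d) z 0 (I k)| <= c) ->
  (forall i, A i -> x 0 i = 0) ->
  (forall i, 0 <= x 0 i * z 0 i) ->
  f_infty d z x <= c ->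
  exists2 delta, 0 < delta &
    sublevel_path (f_infty d z) c x
      (\row_i (if A i then delta * z 0 i else x 0 i)).
Proof.
move=> c0 smallA xA0 xz0 /(f_infty_leP _ _ _ (ltW c0)) fx.
(* A common bound for the coordinates of x and z; the summand 1 keeps it
   positive. *)
pose B := 1 + \sum_i `|x 0 i| + \sum_i `|z 0 i|.
have sum0 (v : 'rV[R]_n) : 0 <= \sum_i `|v 0 i| by apply: sumr_ge0.
have le_sum (v : 'rV[R]_n) i : `|v 0 i| <= \sum_i `|v 0 i|.
  by rewrite (bigD1 i) //= lerDl sumr_ge0.
have B0 : 0 < B by rewrite /B; have := sum0 x; have := sum0 z; lra.
have xB i : `|x 0 i| <= B.
  by rewrite /B; have := le_sum x i; have := sum0 z; lra.
have zB i : `|z 0 i| <= B.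
  by rewrite /B; have := le_sum z i; have := sum0 x; lra.
(* A product that meets A has one factor at most delta * B and d - 1 factors at
   most B. *)
pose delta := Num.min 1 (c / B ^+ d).
have delta0 : 0 < delta by rewrite lt_min ltr01 divr_gt0 // exprn_gt0.
have delta1 : delta <= 1 by rewrite ge_min lexx.
have deltac : delta * B ^+ d <= c.
  by rewrite -ler_pdivlMr ?exprn_gt0 // ge_min lexx orbT.
exists delta => //.
exists (fun t => \row_i (if A i then t * delta * z 0 i else x 0 i)); split.
- apply: continuous_row => j t.
  rewrite (_ : (fun _ => _) = fun t => if A j then t * delta * z 0 j else x 0 j); last first.
    by apply/funext => u; rewrite mxE.
  case: (A j); last exact: cst_continuous.
  apply: (@continuousM _ _ (fun t : R => t * delta)); last exact: cst_continuous.
  by apply: continuousM => //; exact: cst_continuous.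
- by apply/rowP => i; rewrite !mxE; case: ifP => // Ai; rewrite !mul0r xA0.
- by apply/rowP => i; rewrite !mxE mul1r.
move=> t /andP[t0 t1]; apply/f_infty_leP => //; first exact: ltW.
move=> I; under [X in `|X - _|]eq_bigr do rewrite mxE.
have [/existsP[k0 Ak0]|/existsPn nA] := boolP [exists k, A (I k)]; last first.
  rewrite (eq_bigr (fun k => x 0 (I k))); first exact: fx.
  by move=> k _; rewrite (negbTE (nA k)).
set q := \prod_(k < d) z 0 (I k); set p := \prod_(k < d) _.
have qc : `|q| <= c := smallA I k0 Ak0.
have td0 : 0 <= t * delta by rewrite mulr_ge0 // ltW.
have td1 : t * delta <= delta by rewrite ler_piMl // ltW.
have pc : `|p| <= c.
  apply: le_trans deltac.
  have -> : delta * B ^+ d = (delta * B) * B ^+ d.-1.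
    by rewrite -mulrA -exprS prednK // (leq_ltn_trans (leq0n k0)).
  apply: (@normr_prod_le _ _ _ _ _ k0) => [k|].
    case: ifP => _ //; rewrite normrM ger0_norm //.
    by rewrite (le_trans _ (zB (I k))) // ler_piMl // (le_trans td1).
  by rewrite Ak0 normrM ger0_norm // ler_pM.
have pq0 : 0 <= p * q.
  rewrite -big_split /=; apply: prodr_ge0 => k _.
  by case: ifP => _ //; rewrite -(mulrA (t * delta)) mulr_ge0 // -expr2 sqr_ge0.
move: pc qc pq0; rewrite !ler_norml => /andP[p1 p2] /andP[q1 q2] pq0.
apply/andP; split.
  have [p0|p0] := leP 0 p; first lra.
  have : q <= 0 by rewrite leNgt; apply/negP => q0; nra.
  lra.
have [p0|p0] := leP 0 p; last lra.
have [->|pn0] := eqVneq p 0; first lra.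
have : 0 <= q by rewrite -(pmulr_rge0 q (_ : 0 < p)) // lt0r pn0.
lra.
Qed.

Lemma powR_prod (R : realType) (I : Type) (r : seq I) (F : I -> R) (t : R) :
  (forall i, 0 <= F i) ->
  (\prod_(i <- r) F i) `^ t = \prod_(i <- r) F i `^ t.
Proof.
move=> F0; elim: r => [|i r IHr]; first by rewrite !big_nil powR1.
by rewrite !big_cons powRM ?IHr // prodr_ge0.
Qed.

Lemma powR_between (R : realType) (a t : R) :
  0 <= a -> 0 <= t <= 1 -> `|a `^ t - a| <= `|1 - a|.
Proof.
move=> a0 /andP[t0 t1]; have [a1|a1] := leP 1 a.
  have h1 : 1 <= a `^ t by rewrite -(powRr0 a) ler_powR.
  have h2 : a `^ t <= a by rewrite ler1_powR.
  by rewrite !ler0_norm ?subr_le0 // lerN2 lerB.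
have [->|an0] := eqVneq a 0.
  by rewrite /powR eqxx !subr0 normr1 ger0_norm // lern1 leq_b1.
have h0 : 0 < a <= 1 by rewrite lt0r an0 a0 ltW.
have h1 : a `^ t <= 1 by rewrite -(powRr0 a) ger_powR.
have h2 : a <= a `^ t by rewrite -[leLHS](powRr1 a0) ger_powR.
by rewrite !ger0_norm ?subr_ge0 ?(ltW a1) // lerB.
Qed.

(** Linear interpolation would not do: a product of coordinates, some of which
increase and some of which decrease, need not be monotone. With ratios
[r_i = z_i / x_i], the geometric path turns the product [p] into [p * rho^t] where
[rho] is the product of the ratios, and [rho^t] runs monotonically from 1 to
[rho]. *)
Lemma geometric_path (R : realType) (n d : nat) (z x : 'rV[R]_n) (c : R) :
  (forall i, 0 <= x 0 i * z 0 i) ->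
  (forall i, (x 0 i == 0) = (z 0 i == 0)) ->
  f_infty d z x <= c ->
  sublevel_path (f_infty d z) c x z.
Proof.
move=> xz0 xz_eq0 fxc.
have c0 : 0 <= c := le_trans (f_infty_ge0 d z x) fxc.
have {fxc} /(f_infty_leP _ _ _ c0) fx := fxc.
have ratio0 i : 0 <= z 0 i / x 0 i.
  have [->|xn0] := eqVneq (x 0 i) 0; first by rewrite invr0 mulr0.
  rewrite (_ : _ / _ = x 0 i * z 0 i * (x 0 i)^-2); last by field.
  by rewrite mulr_ge0 // invr_ge0 exprn_even_ge0.
exists (fun t => \row_i (x 0 i * (z 0 i / x 0 i) `^ t)); split.
- apply: continuous_row => j t.
  rewrite (_ : (fun _ => _) = fun t => x 0 j * (z 0 j / x 0 j) `^ t); last first.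
    by apply/funext => u; rewrite mxE.
  (* When x_j = z_j = 0 the power is 0 `^ t, which is discontinuous at t = 0, but
     it is multiplied by 0. *)
  have [xj0|xjn0] := eqVneq (x 0 j) 0.
    rewrite (_ : (fun _ => _) = cst 0); first exact: cst_continuous.
    by apply/funext => u /=; rewrite xj0 mul0r.
  have rj0 : z 0 j / x 0 j != 0 by rewrite mulf_neq0 ?invr_neq0 // -xz_eq0.
  apply: continuousM; first exact: cst_continuous.
  rewrite /powR (negbTE rj0).
  apply: (@continuous_comp _ _ _ (fun t : R => t * ln (z 0 j / x 0 j)) expR).
    by apply: continuousM => //; exact: cst_continuous.
  exact: continuous_expR.
- by apply/rowP => i; rewrite !mxE powRr0 mulr1.
- apply/rowP => i; rewrite !mxE powRr1 //.
  have [xi0|xin0] := eqVneq (x 0 i) 0; first by rewrite xi0 mul0r; apply/esym/eqP; rewrite -xz_eq0 xi0.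
  by rewrite mulrC divfK.
move=> t t01; apply/f_infty_leP => // I.
under [X in `|X - _|]eq_bigr do rewrite mxE.
rewrite big_split /= -powR_prod //.
apply: le_trans (fx I).
set p := \prod_(k < d) x 0 (I k); set rho := \prod_(k < d) (_ / _).
have [p0|pn0] := eqVneq p 0; first by rewrite p0 mul0r.
have -> : \prod_(k < d) z 0 (I k) = p * rho.
  rewrite -big_split /=; apply: eq_bigr => k _.
  rewrite mulrC divfK //; apply: contra_neq pn0 => xk0.
  by rewrite /p (bigD1 k) //= xk0 mul0r.
have rho0 : 0 <= rho by apply: prodr_ge0.
by rewrite -mulrBr -[X in _ <= `|X - _|]mulr1 -mulrBr !normrM ler_wpM2l // powR_between.
Qed.

(** For an [i] above the threshold, the multi-index [(i, j, ..., j)] shows that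
[x_i y_i (x_j y_j)^D] is positive. So [x_i y_i] has the sign [s] of
[(x_j y_j)^D], whatever [i] is; if [j] itself is above it, the case [i = j] gives [s^(D+1) = 1]. *)
Lemma aligned_sign (R : realType) (n D : nat) (y x : 'rV[R]_n) (c : R)
    (j : 'I_n) :
  (forall i, `|y 0 i| <= `|y 0 j|) ->
  f_infty D.+1 y x <= c ->
  exists2 s : R, s ^+ D.+1 = 1 &
    forall i, c < `|y 0 i| * `|y 0 j| ^+ D -> 0 < x 0 i * (s * y 0 i).
Proof.
move=> ymax fxc.
have c0 : 0 <= c := le_trans (f_infty_ge0 D.+1 y x) fxc.
have {fxc} /(f_infty_leP _ _ _ c0) fx := fxc.
have same_sign i : c < `|y 0 i| * `|y 0 j| ^+ D ->
    0 < x 0 i * y 0 i * (x 0 j * y 0 j) ^+ D.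
  move=> big_i; pose I := [ffun k : 'I_D.+1 => if k == ord0 then i else j].
  have prodI (v : 'rV[R]_n) : \prod_(k < D.+1) v 0 (I k) = v 0 i * v 0 j ^+ D.
    rewrite big_ord_recl ffunE eqxx; congr (_ * _).
    under eq_bigr do rewrite ffunE /=.
    by rewrite prodr_const card_ord.
  have := fx I; rewrite !prodI.
  rewrite -normrX -normrM in big_i.
  rewrite exprMn (_ : _ * _ * _ = (x 0 i * x 0 j ^+ D) * (y 0 i * y 0 j ^+ D)); last by ring.
  move: big_i; set p := x 0 i * _; set q := y 0 i * _.
  move=> cq; rewrite ler_norml => /andP[pq1 pq2].
  move: cq; have [q0|q0] := leP 0 q => cq.
    by rewrite ger0_norm // in cq; apply: mulr_gt0; lra.
  by rewrite ltr0_norm // in cq; rewrite nmulr_lgt0; lra.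
(* If j itself is below the threshold then so is every coordinate, and any
   admissible sign will do. *)
have [big_j|small_j] := ltP c (`|y 0 j| * `|y 0 j| ^+ D); last first.
  exists 1; first by rewrite expr1n.
  move=> i /(le_lt_trans small_j); rewrite ltNge => /negP[].
  by rewrite ler_wpM2r // exprn_ge0.
set u := x 0 j * y 0 j.
have sgu : Num.sg u ^+ D.+1 = 1.
  by apply/eqP; rewrite -sgrX sgr_cp0 exprS same_sign.
exists (Num.sg u ^+ D); first by rewrite -exprM mulnC exprM sgu expr1n.
move=> i /same_sign; rewrite -/u -sgr_cp0 sgrM (sgrM (x 0 i)) sgrX => /eqP sg1.
by rewrite -sgr_cp0 (sgrM (x 0 i)) (sgrM _ (y 0 i)) sgrX sgr_id; apply/eqP; rewrite -[RHS]sg1; ring.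
Qed.

(** * Reaching a zero, and the theorem *)

Lemma reach_zero (R : realType) (n d : nat) (y x : 'rV[R]_n) (c : R) :
  (1 <= n)%N -> (1 <= d)%N -> 0 < c -> f_infty d y x <= c ->
  exists x1 x2 z, [/\ sublevel_path (f_infty d y) c x x1,
    sublevel_path (f_infty d y) c x1 x2,
    sublevel_path (f_infty d y) c x2 z & f_infty d y z = 0].
Proof.
case: n y x => // n y x _; case: d => // D _ c0 fxc.
have [j _ /(_ _ isT) ymax] := Order.TotalTheory.arg_maxP (fun i => `|y 0 i|) (erefl : predT (@ord0 n)).
pose A i := `|y 0 i| * `|y 0 j| ^+ D <= c.
have smallA (I : {ffun 'I_D.+1 -> 'I_n.+1}) k : A (I k) ->
    `|\prod_(k < D.+1) y 0 (I k)| <= c.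
  by apply: le_trans; apply: normr_prod_le => // k'; apply: ymax.
have [s sd1 aligned] := aligned_sign ymax fxc.
have s0 : s != 0 by apply: contra_eq_neq sd1 => ->; rewrite expr0n eq_sym oner_eq0.
set x1 := \row_i (if A i then 0 else x 0 i).
have path1 : sublevel_path (f_infty D.+1 y) c x x1.
  exact: collapse_path (ltW c0) smallA fxc.
have fx1 : f_infty D.+1 y x1 <= c.
  by case: path1 => g [_ _ <-]; apply; rewrite ler01 lexx.
pose z := s *: y.
have fzE : f_infty D.+1 z = f_infty D.+1 y.
  by apply/funext => v; exact: f_infty_sign.
have smallAz (I : {ffun 'I_D.+1 -> 'I_n.+1}) k : A (I k) ->
    `|\prod_(k < D.+1) z 0 (I k)| <= c.
  move=> /smallA; under [in X in _ -> X]eq_bigr do rewrite mxE.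
  by rewrite big_split /= prodr_const card_ord sd1 mul1r.
have x1A i : A i -> x1 0 i = 0 by rewrite mxE => ->.
have x1z i : ~~ A i -> 0 < x1 0 i * z 0 i.
  by move=> nAi; rewrite !mxE (negbTE nAi) aligned // ltNge.
have xz0 i : 0 <= x1 0 i * z 0 i.
  by have [/x1A ->|/x1z/ltW//] := boolP (A i); rewrite mul0r.
have [|delta delta0] := lift_path c0 smallAz x1A xz0; first by rewrite fzE.
set x2 := \row_i _ => path2.
have fx2 : f_infty D.+1 z x2 <= c.
  by case: path2 => g [_ _ <-]; apply; rewrite ler01 lexx.
exists x1, x2, z; rewrite fzE in path2; split=> //; rewrite -fzE.
  apply: geometric_path fx2 => i; rewrite [x2 0 i]mxE; case: ifPn => [_|/x1z].
  - by rewrite -mulrA mulr_ge0 ?(ltW delta0) // -expr2 sqr_ge0.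
  - exact: ltW.
  - by rewrite mulf_eq0 gt_eqF.
  - have [-> | x10] := eqVneq (x1 0 i) 0; first by rewrite mul0r ltxx.
    by have [->|//] := eqVneq (z 0 i) 0; rewrite mulr0 ltxx.
apply/le_anti; rewrite f_infty_ge0 andbT; apply/f_infty_leP => // I.
by rewrite subrr normr0.
Qed.

Theorem proposition3p2 (R : realType) (n d : nat) (hn : (1 <= n)%N)
    (hd : (1 <= d)%N) (y : 'rV[R]_n) :
  weakly_global [set: 'rV[R]_n] (f_infty d y) /\
  forall x : 'rV[R]_n,
    strict_local_min_point [set: 'rV[R]_n] (f_infty d y) x ->
    global_min_point [set: 'rV[R]_n] (f_infty d y) x.
Proof.
have cf := @continuous_f_infty R n d y.
(* The statement on points follows from this by taking for X a singleton. *)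
have zero_in_min X : strict_local_min_set [set: 'rV[R]_n] (f_infty d y) X ->
    exists2 z, X z & f_infty d y z = 0.
  move=> minX; have [_ X0 cptX _] := minX.
  have [x0 /set_mem Xx0 x0min] := compact_EVT_min X0 cptX (continuous_subspaceT cf).
  have {}x0min u : X u -> f_infty d y x0 <= f_infty d y u.
    by move=> Xu; apply: x0min; exact: mem_set.
  have [fx0|fx0] := eqVneq (f_infty d y x0) 0; first by exists x0.
  have c0 : 0 < f_infty d y x0 by rewrite lt0r fx0 f_infty_ge0.
  have [x1 [x2 [z [g1 g2 g3 fz0]]]] := reach_zero hn hd c0 (lexx (f_infty d y x0)).
  have trap := sublevel_path_trapped minX x0min.
  by exists z => //; apply: (trap _ _ g3); apply: (trap _ _ g2); exact: (trap _ _ g1).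
split.
  split; first exact: continuous_subspaceT.
  move=> X minX; split=> //; have [z Xz fz0] := zero_in_min X minX.
  apply: ge_ereal_inf; exists (f_infty d y z)%:E; first by exists z.
  by apply: le_ereal_inf_tmp => _ [v _ <-]; rewrite lee_fin fz0 f_infty_ge0.
move=> x [_ [eps eps0 minx]]; split=> // v _.
have [|z ->] := zero_in_min [set x]; last by move=> ->; exact: f_infty_ge0.
split=> //; [by exists x|exact: compact_set1|].
by exists eps => // u w -> [_ wx]; apply: minx; split.
Qed.
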